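(* For every integer $n\ge 1$, there are infinitely many $k\in\mathbb N$ such that $$g(k\,p_n\#+1)\ge 2n+1 .$$
   Context: $\mathbb N=\{1,2,3,\dots\}$. The function $f_3:\mathbb N\to\mathbb N$ is defined recursively by $f_3(1)=1$, $f_3(2)=3$, and, for each $n\ge 3$, $f_3(n)$ is the smallest positive integer that is not in $\{f_3(1),\dots,f_3(n-1)\}$ and is coprime with $f_3(n-1)$. For $t\in\mathbb N$, $g(t)=f_3(t+1)-f_3(t)$. Here $p_n$ denotes the $n$-th prime ($p_1=2$) and $p_n\#=\prod_{k=1}^n p_k$ is the $n$-th primorial number. *)

(* Defs.v *)
From mathcomp Require Import all_boot all_order all_algebra.
From mathcomp Require Import classical_sets cardinality.
Set Implicit Arguments.
Unset Strict Implicit.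
Unset Printing Implicit Defensive.

(* f3 and nth_prime are indexed from 1; their value 0 at index 0 is junk. *)

Lemma f3_next_subproof (x : nat) (s : seq nat) :
  exists m, [&& 0 < m, m \notin s & (0 < x) ==> coprime m x].
Proof.
pose M := \sum_(i <- s) i.
have notin_s m : M < m -> m \notin s.
  move=> lt_Mm; apply: contraL lt_Mm => ms.
  by rewrite /M (big_rem _ ms) /= -leqNgt leq_addr.
exists (M * x.-1.+1 + 1); rewrite addn1 /= notin_s ?ltnS ?leq_pmulr //=.
by apply/implyP => x0; rewrite prednK // -addn1 /coprime gcdnC gcdnMDl gcdn1.
Qed.

(* The smallest positive integer not in s and coprime with x.  The guard
   0 < x is what makes it exist for every x and s (only 1 is coprime with 0);
   it always holds in the recursion, see f3P. *)
Definition f3_next (x : nat) (s : seq nat) : nat :=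
  ex_minn (f3_next_subproof x s).

(* f3_seq n = [:: f3 n; ...; f3 1] *)
Fixpoint f3_seq (n : nat) : seq nat :=
  if n is n'.+1 then
    match n' with
    | 0 => 1
    | 1 => 3
    | _ => f3_next (head 0 (f3_seq n')) (f3_seq n')
    end :: f3_seq n'
  else [::].

Definition f3 (n : nat) : nat := head 0 (f3_seq n).

Lemma f3_1 : f3 1 = 1. Proof. by []. Qed.

Lemma f3_2 : f3 2 = 3. Proof. by []. Qed.

Lemma f3_gt0 n : 0 < n -> 0 < f3 n.
Proof.
by case: n => [|[|[|n]]] // _; rewrite /f3 /= /f3_next; case: ex_minnP => m /andP[].
Qed.

Lemma mem_f3_seq n m :
  reflect (exists2 i, 0 < i <= n & m = f3 i) (m \in f3_seq n).
Proof.
elim: n => [|n IHn].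
  by constructor=> -[[|i] //]; rewrite ltn0 andbF.
have -> : f3_seq n.+1 = f3 n.+1 :: f3_seq n by [].
rewrite inE; apply: (iffP orP) => [[/eqP->|/IHn[i /andP[i0 le_in] ->]]|].
- by exists n.+1; rewrite ?ltnSn.
- by exists i; rewrite // i0 leqW.
case=> i /andP[i0]; rewrite leq_eqVlt => /predU1P[-> ->|lt_in mE].
  by left.
by right; apply/IHn; exists i; rewrite // i0.
Qed.

Lemma f3P n (P := fun m => [/\ 0 < m, (forall i, 0 < i < n -> m <> f3 i)
                              & coprime m (f3 n.-1)]) :
  2 < n -> P (f3 n) /\ (forall m, P m -> f3 n <= m).
Proof.
have PE k m : 0 < k ->
    reflect ([/\ 0 < m, (forall i, 0 < i < k.+1 -> m <> f3 i) & coprime m (f3 k)])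
      [&& 0 < m, m \notin f3_seq k & (0 < f3 k) ==> coprime m (f3 k)].
  move=> k0; rewrite f3_gt0 //=; apply: (iffP and3P) => -[m0 ms co]; split=> //.
    by move=> i lei mE; move/mem_f3_seq: ms; apply; exists i.
  by apply/mem_f3_seq => -[i lei mE]; apply: (ms i).
case: n @P => [|[|[|n]]] // P _.
have -> : f3 n.+3 = f3_next (f3 n.+2) (f3_seq n.+2) by [].
rewrite /f3_next; case: ex_minnP => m /PE Pm min_m; split; first exact: Pm.
by move=> k Pk; apply/min_m/PE.
Qed.

Definition g (t : nat) : int := ((f3 t.+1)%:Z - (f3 t)%:Z)%R.

Lemma next_prime_subproof (m : nat) : exists p, (m < p) && prime p.
Proof. by have [p lt_mp pr_p] := prime_above m; exists p; apply/andP. Qed.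

Definition next_prime (m : nat) : nat := ex_minn (next_prime_subproof m).

(* nth_prime 1 = 2, nth_prime 2 = 3, ... *)
Definition nth_prime (n : nat) : nat := iter n next_prime 0.

Lemma nth_primeP n :
  [/\ prime (nth_prime n.+1), nth_prime n < nth_prime n.+1
    & forall p, prime p -> nth_prime n < p -> nth_prime n.+1 <= p].
Proof.
rewrite /= /next_prime; case: ex_minnP => q /andP[lt_q pr_q] min_q.
by split=> // p pr_p lt_p; apply: min_q; rewrite lt_p.
Qed.

Definition primorial (n : nat) : nat := \prod_(1 <= k < n.+1) nth_prime k.

(* Main.v *)
Require Import Defs.
From mathcomp Require Import all_boot all_order all_algebra.
From mathcomp Require Import classical_sets cardinality.
From mathcomp Require Import zify.

Set Implicit Arguments.
Unset Strict Implicit.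
Unset Printing Implicit Defensive.

(** The sequence is rigid enough to be described completely.  For [j >= 1] it takes
the even number [2j] at time [2j+1], and at that time the values already taken are
[1, ..., 2j] together with a single odd number [x > 2j] ([f3_state]).  There
are two regimes.

If [x > 2j+1], the next two values are [2j+1] and [2j+2], and [x] stays ahead
([f3_state_pending]).

If [x = 2j+1], a reset, the values taken form an interval, and the next value
[y] is the least number above [2j+1] coprime with [2j].  Every number in
between shares a factor with [2j], so every prime below [y - 2j] divides [2j]
([reset_gap_prime_dvd]).  A common prime factor of [y] and [2j+2] divides their
difference, hence is below [y - 2j] and divides [2j] too, contradicting the choice
of [y]; so [2j+2] comes after [y], and the description persists with [x = y] ([reset_step]).

Let [P] be the [n]-th primorial.  At a reset with [2i = kP], the jump from [2i]
to [y] is greater than 1 and coprime with [P], so it is at least the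
[n+1]-st prime, which is at least [2n+1] ([reset_jump]).

It remains to find resets at arbitrarily large multiples of [P].  Suppose that
[kP = 2j] is not a reset; then the odd number ahead was chosen at an earlier
reset [2i], with [2i < 2j < y - 1].  A prime factor [q] of [2j - 2i + 1] is
less than [y - 2i], so it divides [2i]; it does not divide [2j], for otherwise
it would divide 1.  So [q] does not divide [P], that is, [q] exceeds the [n]-th
prime.  All primes up to the [n]-th are then below [y - 2i] and divide [2i],
so that [2i = k'P]: the reset was itself at a multiple of [P].  Since
[2i + (2i+1)] is coprime with [2i], [y <= 4i+1], whence [k <= 2k'] and [k']
is unbounded ([large_reset_multiple]). *)

(** * Primorials *)

Lemma dvd_primorial n p : prime p -> (p %| primorial n) = (p <= nth_prime n).
Proof.
move=> pr_p; elim: n => [|n IHn].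
  rewrite /primorial big_geq // dvdn1 /nth_prime /=.
  by case: p pr_p => [|[|p]].
have [pr_q lt_q min_q] := nth_primeP n.
rewrite /primorial big_nat_recr // Euclid_dvdM // -/(primorial n) IHn.
rewrite dvdn_prime2 //; apply/orP/idP => [[le_p|/eqP->//]|le_p].
  exact: leq_trans le_p (ltnW lt_q).
have [|lt_p] := leqP p (nth_prime n); first by left.
by right; rewrite eqn_leq le_p min_q.
Qed.

Lemma primorial_dvd n m :
  (forall p, prime p -> p <= nth_prime n -> p %| m) -> primorial n %| m.
Proof.
elim: n => [|n IHn] dvd_m; first by rewrite /primorial big_geq ?dvd1n.
have [pr_q lt_q _] := nth_primeP n.
rewrite /primorial big_nat_recr // -/(primorial n).
rewrite Gauss_dvd; last first.
  by rewrite coprime_sym prime_coprime // dvd_primorial // -ltnNge.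
rewrite (dvd_m (nth_prime _)) // andbT.
by apply: IHn => p pr_p le_p; apply: dvd_m => //; apply: leq_trans (ltnW lt_q).
Qed.

(** Consecutive primes from 3 on are odd, hence differ by at least 2. *)
Lemma nth_prime_ge n : 2 * n + 1 <= nth_prime n.+1.
Proof.
elim: n => [|n IHn]; first by have [/prime_gt0] := nth_primeP 0.
have [pr_q _ _] := nth_primeP n; have [pr_p lt_qp _] := nth_primeP n.+1.
have [p2|odd_p] := even_prime pr_p; last by move: odd_p IHn lt_qp; lia.
by have := prime_gt1 pr_q; lia.
Qed.

Lemma primorial_gt0 n : 0 < primorial n.
Proof.
elim: n => [|n IHn]; first by rewrite /primorial big_geq.
have [/prime_gt0 q0 _ _] := nth_primeP n.
by rewrite /primorial big_nat_recr // muln_gt0 IHn.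
Qed.

(** * The greedy rule *)

Lemma mem_f3_seqS n m : (m \in f3_seq n.+1) = (m == f3 n.+1) || (m \in f3_seq n).
Proof. by rewrite -in_cons. Qed.

Lemma f3S_spec n (m := f3 n.+1) : 1 < n ->
  [/\ 0 < m, m \notin f3_seq n, coprime m (f3 n)
    & forall m', 0 < m' -> m' \notin f3_seq n -> coprime m' (f3 n) -> m <= m'].
Proof.
move=> n1; have [|[m0 new_m co_m] min_m] := @f3P n.+1; first by [].
split=> // [|m' m'0 new_m' co_m'].
  by apply/mem_f3_seq => -[i lei mE]; apply: (new_m i).
apply: min_m; split=> // i lei mE.
by move/mem_f3_seq: new_m'; apply; exists i.
Qed.

(** When the values taken fill every place below an unused [m], the greedy choice
is [m] as soon as coprimality allows it. *)
Lemma f3S_first n m : 1 < n -> 0 < m -> m \notin f3_seq n -> coprime m (f3 n) ->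
  (forall m', 0 < m' < m -> m' \in f3_seq n) -> f3 n.+1 = m.
Proof.
move=> n1 m0 new_m co_m used_lt; have [k0 new_k _ min_k] := f3S_spec n1.
apply/eqP; rewrite eqn_leq min_k //= leqNgt; apply: contra new_k => lt_k.
by apply: used_lt; rewrite k0.
Qed.

(** * The shape of the sequence *)

(** Allowing [x = 2j+1] makes a reset the special case in which the one value
beyond [2j] is the next integer, so that a single invariant covers both
regimes. *)
Definition f3_state j x :=
  [/\ f3 j.*2.+1 = j.*2, odd x, j.*2 < x
    & forall m, (m \in f3_seq j.*2.+1) = (0 < m <= j.*2) || (m == x)].

(** The moments at which the values taken fill the interval [1, ..., 2i+1]. *)
Definition f3_reset i := f3_state i i.*2.+1.

(** Consecutive integers are coprime, so the sequence just fills in [2j+1] and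
[2j+2] while [x] waits ahead. *)
Lemma f3_state_pending j x : 0 < j -> f3_state j x -> j.*2.+1 < x ->
  f3_state j.+1 x.
Proof.
move=> j0 [fj odd_x _ used] lt_x.
have f1 : f3 j.*2.+2 = j.*2.+1.
  apply: f3S_first => //; rewrite ?used; [lia|lia| |].
    by rewrite fj coprimeSn.
  by move=> m' ?; rewrite used; lia.
have used1 m : (m \in f3_seq j.*2.+2) = (0 < m <= j.*2.+1) || (m == x).
  by rewrite mem_f3_seqS f1 used; lia.
have f2 : f3 j.*2.+3 = j.*2.+2.
  apply: f3S_first => //; rewrite ?used1; [lia| |].
    by rewrite f1 coprimeSn.
  by move=> m' ?; rewrite used1; lia.
split; rewrite ?doubleS //; first lia.
by move=> m; rewrite mem_f3_seqS f2 used1; lia.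
Qed.

Section Reset.

Variable i : nat.
Hypotheses (i0 : 0 < i) (reset_i : f3_reset i).
Let y := f3 i.*2.+2.

Lemma reset_next_spec :
  [/\ i.*2.+1 < y, coprime y i.*2
    & forall m, i.*2.+1 < m -> coprime m i.*2 -> y <= m].
Proof.
have [fi _ _ used] := reset_i.
have [|y0 new_y co_y min_y] := @f3S_spec i.*2.+1; first lia.
rewrite fi in co_y min_y; rewrite used in new_y; rewrite -/y in y0 new_y co_y min_y.
split=> //; first by move: new_y; lia.
by move=> m lt_m co_m; apply: min_y => //; rewrite ?used; lia.
Qed.

Lemma reset_next_odd : odd y.
Proof.
have [_ co_y _] := reset_next_spec; rewrite -coprimen2.
by move: co_y; rewrite -muln2 coprimeMr => /andP[].
Qed.

(** For an odd prime [q], the number [2i+q] exceeds [2i+1] and is less than [y],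
so it is not coprime with [2i]; but [gcd (2i+q) (2i) = gcd q (2i)]. *)
Lemma reset_gap_prime_dvd q : prime q -> q < y - i.*2 -> q %| i.*2.
Proof.
move=> pr_q lt_q; have [_ _ min_y] := reset_next_spec.
have [->|odd_q] := even_prime pr_q; first by rewrite dvdn2 odd_double.
apply: contraLR lt_q => ndvd_q; rewrite -leqNgt leq_subLR; apply: min_y.
  by have := prime_gt1 pr_q; lia.
by rewrite /coprime gcdnC gcdnDl gcdnC -/(coprime _ _) prime_coprime.
Qed.

(** The candidate [2i + (2i+1)] is coprime with [2i], which bounds the greedy
choice. *)
Lemma reset_next_le : y <= i.*2.*2.+1.
Proof.
have [_ _ min_y] := reset_next_spec; apply: min_y; first lia.
by rewrite /coprime -addnn -addnS gcdnC gcdnDl -/(coprime _ _) coprimenS.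
Qed.

(** The sequence returns to the evens right after [y].  This needs [y] coprime
with [2i+2]: a common prime factor [p] divides [y - (2i+2)], so it is below
[y - 2i] and divides [2i], although [y] is coprime with [2i]. *)
Lemma reset_step : f3_state i.+1 y.
Proof.
have [lt_y co_y _] := reset_next_spec; have odd_y := reset_next_odd.
have [fi _ _ used] := reset_i.
have used1 m : (m \in f3_seq i.*2.+2) = (0 < m <= i.*2.+1) || (m == y).
  by rewrite mem_f3_seqS used -/y; lia.
have co_y2 : coprime i.*2.+2 y.
  rewrite coprime_sym /coprime; apply: contraT => ng1.
  have [|p pr_p /[!dvdn_gcd]/andP[p_y p_i]] := @pdivP (gcdn y i.*2.+2).
    by have := gcdn_gt0 y i.*2.+2; lia.
  have p_gap : p %| y - i.*2.+2 by rewrite dvdn_sub.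
  have dvd_i : p %| i.*2.
    by apply: reset_gap_prime_dvd => //; have := dvdn_leq _ p_gap; lia.
  have : p %| gcdn y i.*2 by rewrite dvdn_gcd p_y.
  by rewrite (eqP co_y) dvdn1 => /eqP p1; rewrite p1 in pr_p.
have f2 : f3 i.*2.+3 = i.*2.+2.
  apply: f3S_first => //; first by rewrite used1; lia.
  by move=> m' ?; rewrite used1; lia.
split; rewrite ?doubleS //; first lia.
by move=> m; rewrite mem_f3_seqS f2 used1; lia.
Qed.

End Reset.

Lemma f3_reset1 : f3_reset 1.
Proof.
have f3_3 : f3 3 = 2.
  by apply: f3S_first => // -[|[|m]] //.
by split=> // m; rewrite mem_f3_seqS f3_3 !inE; lia.
Qed.

(** The odd number ahead does not change between resets, so it remembers the reset
[2i] at which it was chosen; keeping track of [i] is what links an arbitrary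
multiple of the primorial to a reset. *)
Lemma f3_reset_or_gap j : 0 < j ->
  f3_reset j \/
  exists i, [/\ 0 < i < j, f3_reset i, j.*2.+1 < f3 i.*2.+2
              & f3_state j (f3 i.*2.+2)].
Proof.
elim: j => // -[_ _|j IHj _]; first by left; apply: f3_reset1.
have next i : 0 < i < j.+2 -> f3_reset i -> f3_state j.+2 (f3 i.*2.+2) ->
  f3_reset j.+2 \/ exists i, [/\ 0 < i < j.+2, f3_reset i,
    j.+2.*2.+1 < f3 i.*2.+2 & f3_state j.+2 (f3 i.*2.+2)].
  move=> lti ri st; case: (ltngtP j.+2.*2.+1 (f3 i.*2.+2)) => [lt|gt|eq].
  - by right; exists i.
  - by have [_ _] := st; lia.
  - by left; rewrite /f3_reset eq.
have [//|reset_j|[i [lti ri lt st]]] := IHj.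
  by apply: (next j.+1) => //; [lia|apply: reset_step].
by apply: (next i) => //; [lia|apply: f3_state_pending].
Qed.

(** * Resets at multiples of a primorial *)

(** If [kP = 2j] is skipped over by the gap opened at a reset [2i], that gap is so
long that it forces [P] to divide [2i]. *)
Lemma large_reset_multiple n k : 0 < n -> 0 < k ->
  exists2 k', k <= k'.*2 &
    exists2 i, 0 < i & i.*2 = k' * primorial n /\ f3_reset i.
Proof.
move=> n0 k0; set P := primorial n.
have evenP : 2 %| P.
  rewrite dvd_primorial //; case: n n0 {P} => // n _.
  by have [/prime_gt1] := nth_primeP n.
have P0 : 0 < P by apply: primorial_gt0.
have [j kPE] : exists j, k * P = j.*2.
  by case/dvdnP: evenP => h ->; exists (k * h); rewrite mulnA muln2.
have j0 : 0 < j by rewrite -double_gt0 -kPE muln_gt0 k0.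
have [reset_j|[i [/andP[i0 lt_ij] reset_i lt_y _]]] := f3_reset_or_gap j0.
  by exists k; [lia|exists j].
(* A prime factor of 2j - 2i + 1 cannot divide both 2i and 2j, and it is small
   enough for the gap at 2i to make it divide 2i. *)
have [|q pr_q q_dvd] := @pdivP (j.*2 - i.*2).+1; first lia.
have q_le := dvdn_leq (ltn0Sn _) q_dvd.
have q_i : q %| i.*2 by apply: reset_gap_prime_dvd => //; lia.
have q_gt : nth_prime n < q.
  rewrite ltnNge -dvd_primorial //; apply/negP => q_P.
  have : q %| j.*2 - i.*2 by rewrite dvdn_sub // -kPE dvdn_mull.
  by move/dvdn_addr => /(_ 1); rewrite addn1 q_dvd Euclid_dvd1.
have /dvdnP[k' iE] : P %| i.*2.
  apply: primorial_dvd => p pr_p le_p.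
  by apply: reset_gap_prime_dvd => //; lia.
exists k'; last by exists i.
have y_le := reset_next_le i0 reset_i.
by rewrite -(leq_pmul2r P0) kPE -doubleMl -iE; lia.
Qed.

(** The jump at a reset is greater than 1 and coprime with the primorial, so its
prime factors come after the [n]-th prime. *)
Lemma reset_jump n k i : 0 < i -> i.*2 = k * primorial n -> f3_reset i ->
  ((2 * n + 1)%N%:Z <= g (k * primorial n + 1))%R.
Proof.
move=> i0 iE reset_i; have [fi _ _ _] := reset_i.
rewrite /g -iE (addn1 i.*2) fi.
have [lt_y co_y _] := reset_next_spec i0 reset_i.
move: lt_y co_y; set y := f3 _ => lt_y co_y.
have [|q pr_q q_dvd] := @pdivP (y - i.*2); first lia.
suff : nth_prime n.+1 <= q.
  by have := nth_prime_ge n; have := dvdn_leq _ q_dvd; lia.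
have [_ _ min_q] := nth_primeP n; apply: min_q => //.
rewrite ltnNge -dvd_primorial //; apply/negP => q_P.
have q_i : q %| i.*2 by rewrite iE dvdn_mull.
have q_y : q %| y by rewrite -(dvdn_subl _ q_i) //; lia.
have : q %| gcdn y i.*2 by rewrite dvdn_gcd q_y.
by rewrite (eqP co_y) Euclid_dvd1.
Qed.

Theorem proposition2p3 (n : nat) (hn : (1 <= n)%N) :
  infinite_set
    [set k : nat | (0 < k)%N /\
       ((2 * n + 1)%N%:Z <= g (k * primorial n + 1))%R]%classic.
Proof.
move=> /finite_seqP[s sE].
(* If s lists all such k, a reset multiplier exceeding every entry of s contradicts
   this. *)
have [k le_k [i i0 [iE reset_i]]] :=
  @large_reset_multiple n (\max_(m <- s) m).+1.*2 hn isT.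
have : [set` s]%classic k.
  rewrite -sE /=; split; first lia.
  exact: reset_jump i0 iE reset_i.
move=> /= ks; have := @leq_bigmax_seq _ s xpredT id k ks isT.
lia.
Qed.
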